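(* Let $t_1$ and $t_2$ be positive even integers such that $t_1 \in \{4,6\}$ and $t_1+t_2 \geqslant 14$, and let $n=t_1+t_2$. Then the complete symmetric digraph $K^*_n$ admits a $(\vec{C}_{t_1},\vec{C}_{t_2})$-factorization, i.e. the directed Oberwolfach problem $\mathrm{OP}^*(t_1,t_2)$ has a solution.
   Context: All digraphs are strict (no loops, no parallel arcs). $K^*_n$ is the complete symmetric digraph on $n$ vertices (for each ordered pair of distinct vertices $(x,y)$ there is exactly one arc from $x$ to $y$). $\vec{C}_m$ denotes a directed cycle with $m$ arcs. A $(\vec{C}_{t_1},\vec{C}_{t_2})$-factor of a digraph $G$ is a spanning subdigraph of $G$ that is the vertex-disjoint union of a directed $t_1$-cycle and a directed $t_2$-cycle. A $(\vec{C}_{t_1},\vec{C}_{t_2})$-factorization of $G$ is a set of pairwise arc-disjoint $(\vec{C}_{t_1},\vec{C}_{t_2})$-factors of $G$ whose arc sets together cover all arcs of $G$. *)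

(* Defs.v *)
From mathcomp Require Import all_boot.
Set Implicit Arguments.
Unset Strict Implicit.
Unset Printing Implicit Defensive.

(* A digraph with vertex set T is given by its arc set G : {set T * T}; the
   pair (x, y) is the arc from x to y.  Parallel arcs are thus impossible, and
   a spanning subdigraph of G is a subset of G. *)

Definition complete_symmetric_digraph (n : nat) : {set 'I_n * 'I_n} :=
  [set a | a.1 != a.2].

Section Factors.

Variable T : finType.

(* [next c x] is the cyclic successor of x in c, so the last vertex of c is
   followed by the first one.  The bound 1 < m excludes loops. *)
Definition directed_cycle (m : nat) (V : {set T}) (A : {set T * T}) : Prop :=
  1 < m /\
  exists c : seq T,
    [/\ uniq c, size c = m, V = [set x in c] & A = [set (x, next c x) | x in c]].

Definition two_cycle_factor (t1 t2 : nat) (G F : {set T * T}) : Prop :=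
  F \subset G /\
  exists (V1 V2 : {set T}) (A1 A2 : {set T * T}),
    [/\ directed_cycle t1 V1 A1, directed_cycle t2 V2 A2,
        [disjoint V1 & V2], V1 :|: V2 = [set: T] & F = A1 :|: A2].

Definition two_cycle_factorization (t1 t2 : nat) (G : {set T * T})
    (P : {set {set T * T}}) : Prop :=
  [/\ forall F : {set T * T}, F \in P -> two_cycle_factor t1 t2 G F,
      trivIset P & cover P = G].

End Factors.

(* Main.v *)
Require Import Defs.
From mathcomp Require Import all_boot zify.

Set Implicit Arguments.
Unset Strict Implicit.
Unset Printing Implicit Defensive.

(** Let n = 2 m and pair the vertices into m columns: the residues modulo N = m - 1 and one extra
    column N.  The edges of K_m fall into N classes according to the sum of their ends modulo N,
    where the edge from the extra column to a counts as a + a.  Classes 2 i and 2 i + 1 together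
    form the zigzag Hamilton cycle N, i, i + 1, i - 1, i + 2, ...

    Replacing each column of a Hamilton cycle by its two vertices, with no arc inside the columns,
    gives a graph that splits into two copies of any bipartite 2-factor (Haeggkvist), hence into
    four directed factors.  This serves all classes but the last ones, which must absorb the arcs
    inside the columns.  If m is even, the last three classes form a ladder closed up through two
    columns, and seven factors are needed.  If m is odd, the last four classes form two zigzags,
    which need five and four factors exchanging a few arcs.

    In each case one small factorization, found by computer, contains a cut across which every
    long cycle runs so regularly that a zone of four vertices can be inserted any number of times,
    without touching the short cycles.  As the arcs are the same relative to each copy of the
    zone, the whole family is covered by one finite check.  K_14 with cycles of lengths 6 and 8
    has its own list of factors. *)

(** * Counting arcs: a small enough cover by factors is a factorization *)

Lemma card_two_cycle_factor (T : finType) (t1 t2 : nat) (G F : {set T * T}) :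
  two_cycle_factor t1 t2 G F -> #|F| <= t1 + t2.
Proof.
have card_cycle m V A : @directed_cycle T m V A -> #|A| <= m.
  case=> _ [c [_ <- _ ->]].
  by apply: leq_trans (leq_imset_card _ _) (card_size c).
case=> _ [V1 [V2 [A1 [A2 [h1 h2 _ _ ->]]]]].
apply: leq_trans (leq_add (card_cycle _ _ _ h1) (card_cycle _ _ _ h2)).
by rewrite cardsU leq_subr.
Qed.

Lemma card_complete_symmetric_digraph (n : nat) :
  #|complete_symmetric_digraph n| = n * n.-1.
Proof.
have -> : complete_symmetric_digraph n = ~: [set (i, i) | i : 'I_n].
  apply/setP=> -[x y]; rewrite !inE /=; congr (~~ _).
  by apply/eqP/imsetP => [->|[i _ [-> ->]]//]; exists y.
rewrite cardsCs setCK card_imset; last by move=> i j [].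
by rewrite card_prod !card_ord -[X in _ - X]muln1 -mulnBr subn1.
Qed.

(* n - 1 factors of n arcs each that cover all n (n - 1) arcs must be pairwise disjoint. *)
Lemma factorization_of_cover (n t1 t2 : nat) (s : seq {set 'I_n * 'I_n}) :
    n = t1 + t2 -> size s <= n.-1 ->
    (forall F, F \in s ->
       two_cycle_factor t1 t2 (complete_symmetric_digraph n) F) ->
    (forall x y : 'I_n, x != y -> exists2 F, F \in s & (x, y) \in F) ->
  two_cycle_factorization t1 t2 (complete_symmetric_digraph n) [set F in s].
Proof.
move=> n_t size_s s_factor s_cover.
have coverP : cover [set F in s] = complete_symmetric_digraph n.
  apply/eqP; rewrite eqEsubset; apply/andP; split; apply/subsetP => -[x y].
    case/bigcupP=> F; rewrite inE => Fs; apply/subsetP.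
    by case: (s_factor F Fs).
  rewrite inE /= => /s_cover[F Fs Fxy]; apply/bigcupP; exists F => //.
  by rewrite inE.
split=> // [F|]; first by rewrite inE => /s_factor.
(* [leq_card_cover] is an equality exactly for a [trivIset], so it is enough to bound the sum of the
   cardinals by the number of arcs. *)
rewrite -(geq_leqif (leq_card_cover _)) coverP card_complete_symmetric_digraph.
apply: (@leq_trans (\sum_(F in [set F in s]) n)).
  apply: leq_sum => F; rewrite inE => /s_factor/card_two_cycle_factor.
  by rewrite -n_t.
rewrite sum_nat_const mulnC leq_mul2l cardsE.
by rewrite (leq_trans (card_size s) size_s) orbT.
Qed.

(** * Strips with a repeated zone and their cycles *)

Definition dicycle (T : finType) (c : seq T) : {set T * T} :=
  [set (x, next c x) | x in c].

(* A closed strip of [n0 + 4 * K] labels.  The labels below [n0] form the base; the four labels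
   [n0, .., n0 + 3] form a zone that is repeated [K] times before the strip closes up. *)
Section Strip.

Variables n0 K : nat.

Definition label_type (x : nat) : nat :=
  if x < n0 then x else n0 + (x - n0) %% 4.

(* [s] encodes the label [s - 4] relative to the zone copy of [x]. *)
Definition arc_target (x s : nat) : nat :=
  (s + 4 * ((x - n0) %/ 4) + (n0 + 4 * K) - 4) %% (n0 + 4 * K).

(* A stretch [(p, (down, l))] of a cycle follows [p] in the base and then [l] in every copy of the
   zone, from the last copy to the first if [down] holds. *)
Definition stretch : Type := (seq nat * (bool * seq nat))%type.

Definition zone_run (down : bool) (l : seq nat) : seq nat :=
  flatten [seq map (addn (4 * k)) l
          | k <- if down then rev (iota 0 K) else iota 0 K].

Definition expand (c : seq stretch) : seq nat :=
  flatten [seq r.1 ++ zone_run r.2.1 r.2.2 | r <- c].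

End Strip.

(* A short cycle inside the base, and the stretches of a long cycle. *)
Definition strip_factor : Type := (seq nat * seq stretch)%type.

(* In the strip with one copy of the zone, an arc between the first four labels and the zone runs
   across the end of the strip. *)
Definition encode_arc (n0 x y : nat) : nat :=
  if (x < 4) && (n0 <= y) then y - n0
  else if (n0 <= x) && (y < 4) then y + n0 + 8
  else y + 4.

(* The relative arcs do not depend on the number of copies of the zone, and are read off
   the strip with one copy. *)
Definition arc_table (n0 : nat) (c : strip_factor) : seq nat :=
  [seq encode_arc n0 x (next (if x \in c.1 then c.1 else expand 1 c.2) x)
  | x <- iota 0 (n0 + 4)].

Section StripChecks.

Variables (n0 : nat) (tab : seq nat).

Definition base_arc : rel nat :=
  fun x y => [&& x < n0, y < n0 & nth 0 tab x == y + 4].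

Definition zone_arc : rel nat :=
  fun x y => [&& n0 <= x < n0 + 4, n0 <= y < n0 + 4 & nth 0 tab x == y + 4].

(** Here [h] is the label that follows the stretch. Going up, the codes [a + 4] and [a + 8] enter
    the first copy and pass to the next one; past the last copy, [a == h + n0] makes the same
    relative arc close up at [h]. Going down, the codes [a - n0] and [a] enter the last copy across
    the end of the strip and pass to the previous one; below the first copy the target is
    [a - 4 = h]. With no copy at all, the entering arc leads straight to [h]. *)
Definition stretch_ok (r : stretch) (h : nat) : bool :=
  let: (p, (down, l)) := r in
  if p isn't x :: p' then false else
  path base_arc x p' &&
  if l isn't a :: l' then base_arc (last x p') h else
  [&& path zone_arc a l', n0 <= a < n0 + 4, last x p' < n0, h < n0,
      n0 <= last a l' < n0 + 4 &
      if down then [&& nth 0 tab (last x p') + n0 == a,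
                       nth 0 tab (last a l') == a & a == h + 4]
      else [&& nth 0 tab (last x p') == a + 4,
               nth 0 tab (last a l') == a + 8 & a == h + n0]].

Fixpoint stretches_ok (s : seq stretch) (h : nat) : bool :=
  if s is r :: s' then
    stretch_ok r (if s' is r' :: _ then head 0 r'.1 else h) && stretches_ok s' h
  else true.

Definition cycles_ok (t1 : nat) (c : strip_factor) : bool :=
  [&& 3 < n0, 1 < t1, size c.1 == t1, cycle base_arc c.1,
      perm_eq (c.1 ++ flatten [seq r.1 | r <- c.2]) (iota 0 n0),
      perm_eq (flatten [seq r.2.2 | r <- c.2]) (iota n0 4) &
      (if c.2 is r :: _ then stretches_ok c.2 (head 0 r.1) else false)].

End StripChecks.

Definition strip_factor_ok (n0 : nat) (c : strip_factor) (t1 : nat) : bool :=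
  cycles_ok n0 (arc_table n0 c) t1 c.

Section StripFactorTheory.

Variables (n0 K : nat) (tab : seq nat).
Hypothesis n0_gt3 : 3 < n0.

Local Notation n := (n0 + 4 * K).

Definition strip_succ (x : nat) : nat :=
  arc_target n0 K x (nth 0 tab (label_type n0 x)).

Lemma label_type_zone (k a : nat) :
  n0 <= a < n0 + 4 -> label_type n0 (4 * k + a) = a.
Proof. by rewrite /label_type => a_zone; case: ltnP; lia. Qed.

Lemma arc_target_zone (k a s : nat) : n0 <= a < n0 + 4 ->
  arc_target n0 K (4 * k + a) s = (s + 4 * k + n - 4) %% n.
Proof.
move=> a_zone; rewrite /arc_target.
by have -> : (4 * k + a - n0) %/ 4 = k by lia.
Qed.

Lemma strip_succ_zone (k a : nat) : n0 <= a < n0 + 4 ->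
  strip_succ (4 * k + a) = (nth 0 tab a + 4 * k + n - 4) %% n.
Proof. by move=> a_zone; rewrite /strip_succ label_type_zone // arc_target_zone. Qed.

Lemma strip_succ_base (x : nat) : x < n0 ->
  strip_succ x = (nth 0 tab x + n - 4) %% n.
Proof.
move=> x_lt; rewrite /strip_succ /label_type x_lt /arc_target.
have -> : (x - n0) %/ 4 = 0 by lia.
by rewrite muln0 addn0.
Qed.

Lemma modn_wrap (y : nat) : y < n -> (y + n) %% n = y.
Proof. by move=> y_lt; rewrite modnDr modn_small. Qed.

Lemma base_arc_succ (x y : nat) : base_arc n0 tab x y -> strip_succ x = y.
Proof.
case/and3P=> x_lt y_lt /eqP Exy; rewrite strip_succ_base // Exy.
rewrite (_ : _ - 4 = y + n); last by lia.
by rewrite modn_wrap //; lia.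
Qed.

Lemma zone_arc_succ (k x y : nat) : k < K -> zone_arc n0 tab x y ->
  strip_succ (4 * k + x) = 4 * k + y.
Proof.
move=> k_lt /and3P[x_zone y_zone /eqP Exy]; rewrite strip_succ_zone // Exy.
rewrite (_ : _ - 4 = 4 * k + y + n); last by lia.
by rewrite modn_wrap //; lia.
Qed.

Lemma base_path (x : nat) (p : seq nat) :
  path (base_arc n0 tab) x p -> path (frel strip_succ) x p.
Proof. by apply: sub_path => y z /base_arc_succ /eqP. Qed.

Lemma zone_path (k x : nat) (l : seq nat) : k < K ->
  path (zone_arc n0 tab) x l ->
  path (frel strip_succ) (4 * k + x) (map (addn (4 * k)) l).
Proof.
move=> k_lt; rewrite path_map.
by apply: sub_path => y z /(zone_arc_succ k_lt) /eqP.
Qed.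

(** Induction on the number [j] of copies still ahead. The hypothesis on [x] is taken modulo [n], so
    that for [j = 0] the entry into a copy beyond the last one is [h]. *)
Lemma zone_run_up (a : nat) (l : seq nat) (h x j k : nat) :
    path (zone_arc n0 tab) a l -> n0 <= a < n0 + 4 ->
    n0 <= last a l < n0 + 4 -> a = h + n0 ->
    nth 0 tab (last a l) = a + 8 ->
    j + k = K -> strip_succ x = (a + 4 * k) %% n ->
  path (frel strip_succ) x
    (rcons (flatten [seq map (addn (4 * i)) (a :: l) | i <- iota k j]) h).
Proof.
move=> a_l a_zone last_zone a_h last_arc.
elim: j k x => [|j IHj] k x jk x_succ /=.
  rewrite x_succ (_ : a + 4 * k = h + n); last by lia.
  by rewrite modn_wrap ?eqxx //; lia.
rewrite rcons_cat cat_path x_succ zone_path //; last by lia.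
rewrite (_ : _ %% _ = 4 * k + a) ?eqxx /=; last by rewrite modn_small; lia.
rewrite last_map; apply: IHj; first by lia.
by rewrite strip_succ_zone // last_arc -[RHS]modnDr; congr (_ %% _); lia.
Qed.

(** Here [j] copies remain below, and [a + 4 * j - 4] is [a] in the highest of them; for [j = 0] it
    is [h]. *)
Lemma zone_run_down (a : nat) (l : seq nat) (h x j : nat) :
    path (zone_arc n0 tab) a l -> n0 <= a < n0 + 4 ->
    n0 <= last a l < n0 + 4 -> a = h + 4 -> h < n0 ->
    nth 0 tab (last a l) = a ->
    j <= K -> strip_succ x = (a + 4 * j + n - 4) %% n ->
  path (frel strip_succ) x
    (rcons (flatten [seq map (addn (4 * i)) (a :: l) | i <- rev (iota 0 j)]) h).
Proof.
move=> a_l a_zone last_zone a_h h_lt last_arc.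
elim: j x => [|j IHj] x jk x_succ.
  rewrite /= x_succ (_ : _ - _ = h + n); last by lia.
  by rewrite modn_wrap ?eqxx //; lia.
rewrite -[in iota 0 j.+1]addn1 iotaD rev_cat /= rcons_cat cat_path x_succ.
rewrite zone_path ?add0n //.
rewrite (_ : _ - 4 = 4 * j + a + n); last by lia.
rewrite modn_wrap ?eqxx /=; last by lia.
rewrite last_map; apply: IHj; first by lia.
by rewrite strip_succ_zone // last_arc; congr (_ %% _); lia.
Qed.

Lemma stretch_path (r : stretch) (h : nat) : stretch_ok n0 tab r h ->
  path (frel strip_succ) (head 0 r.1)
    (rcons (behead r.1 ++ zone_run K r.2.1 r.2.2) h).
Proof.
case: r => -[|y p] [down l] //= /andP[y_p ok].
rewrite rcons_cat cat_path base_path //=.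
case: l ok => [|a l].
  move=> /base_arc_succ last_p.
  rewrite /zone_run (_ : flatten _ = [::]) /= ?last_p ?eqxx //.
  by elim: (if down then _ else _).
case/and4P=> a_l a_zone last_p /and3P[h_lt last_l].
rewrite /zone_run; case: down => /and3P[/eqP p_arc /eqP l_arc /eqP a_h].
  apply: zone_run_down => //; rewrite strip_succ_base //.
  by rewrite -[LHS]modnDr; congr (_ %% _); lia.
apply: (@zone_run_up _ _ _ _ K 0) => //; first by rewrite addn0.
rewrite strip_succ_base // p_arc (_ : _ - 4 = a + 4 * 0 + n); last by lia.
by rewrite modnDr.
Qed.

Lemma stretches_cycle (s : seq stretch) (r : stretch) :
  stretches_ok n0 tab (r :: s) (head 0 r.1) ->
  cycle (frel strip_succ) (expand K (r :: s)).
Proof.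
have r_cons r' h : stretch_ok n0 tab r' h -> r'.1 = head 0 r'.1 :: behead r'.1.
  by case: r' => [[|y p] [d l]].
have spath (h : nat) : forall s r, stretches_ok n0 tab (r :: s) h ->
    path (frel strip_succ) (head 0 r.1) (rcons (behead (expand K (r :: s))) h).
  elim=> [|r2 s2 IHs] r1.
    rewrite /expand /= cats0 andbT => r1_ok.
    by rewrite (r_cons _ _ r1_ok) /=; apply: stretch_path.
  rewrite [stretches_ok _ _ _ _]/= => /andP[r1_ok s_ok].
  have := IHs _ s_ok; have := stretch_path r1_ok.
  have /= /andP[r2_ok _] := s_ok.
  rewrite /expand /= (r_cons _ _ r1_ok) (r_cons _ _ r2_ok) /=.
  rewrite rcons_path => /andP[r1_path /eqP r1_last] r2_path.
  by rewrite rcons_cat cat_path r1_path /= r1_last eqxx.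
move=> ok; have := spath _ _ _ ok; move: ok => /= /andP[r_ok _].
by rewrite /expand /= (r_cons _ _ r_ok).
Qed.

End StripFactorTheory.

(** * From cycles of labels to directed cycles of vertices *)

Lemma next_cons (T : eqType) (x : T) (s : seq T) : next (x :: s) x = head x s.
Proof. by case: s => [|y s] /=; rewrite eqxx. Qed.

Lemma next_map_uniq (T1 T2 : eqType) (v : T1 -> T2) (c : seq T1) (x : T1) :
  uniq (map v c) -> x \in c -> next (map v c) (v x) = v (next c x).
Proof.
move=> c_uniq cx; case: (rot_to cx) => i s rot_c.
rewrite -(next_rot i c_uniq) -(next_rot i (map_uniq c_uniq)) -map_rot rot_c.
rewrite map_cons.
by rewrite !next_cons; case: s {rot_c}.
Qed.

Lemma dicycle_complete (n : nat) (c : seq 'I_n) :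
  uniq c -> 1 < size c -> dicycle c \subset complete_symmetric_digraph n.
Proof.
move=> c_uniq c_size; apply/subsetP => _ /imsetP[x cx ->]; rewrite inE /=.
case: (rot_to cx) => i [|y s] rot_c.
  by move: c_size; rewrite -(size_rot i) rot_c.
rewrite -(next_rot i c_uniq) rot_c next_cons /=.
by move: c_uniq; rewrite -(rot_uniq i) rot_c /= inE negb_or => /andP[/andP[]].
Qed.

Lemma uniq_of_cover (n : nat) (c : seq 'I_n) :
  size c <= n -> (forall x, x \in c) -> uniq c.
Proof.
move=> c_size cover; apply: (@leq_size_uniq _ (enum 'I_n)).
- exact: enum_uniq.
- by move=> x _; apply: cover.
- by rewrite size_enum_ord.
Qed.

Lemma two_cycle_factor_dicycles (n t1 t2 : nat) (c1 c2 : seq 'I_n) :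
    1 < t1 -> 1 < t2 -> size c1 = t1 -> size c2 = t2 ->
    uniq (c1 ++ c2) -> (forall x, x \in c1 ++ c2) ->
  two_cycle_factor t1 t2 (complete_symmetric_digraph n)
    (dicycle c1 :|: dicycle c2).
Proof.
move=> t1_gt1 t2_gt1 size1 size2; rewrite cat_uniq => /and3P[uniq1 disj uniq2] cover.
split; first by rewrite subUset !dicycle_complete ?size1 ?size2.
exists [set x in c1], [set x in c2], (dicycle c1), (dicycle c2); split=> //.
- by split=> //; exists c1.
- by split=> //; exists c2.
- rewrite disjoint_subset; apply/subsetP => x; rewrite !inE => c1x.
  by apply: contra disj => c2x; apply/hasP; exists x.
- by apply/setP=> x; rewrite !inE -mem_cat cover.
Qed.

Section StripVertices.

Variables (n' n0 K t1 : nat) (c : strip_factor) (v : nat -> 'I_n'.+1).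
Hypothesis n_strip : n'.+1 = n0 + 4 * K.
Hypothesis c_ok : strip_factor_ok n0 c t1.
Hypothesis v_surj : forall y, exists2 x, x < n'.+1 & v x = y.

Definition strip_arcs : {set 'I_n'.+1 * 'I_n'.+1} :=
  dicycle (map v c.1) :|: dicycle (map v (expand K c.2)).

Lemma mem_zone_run (down : bool) (l : seq nat) (k a : nat) :
  k < K -> a \in l -> a + 4 * k \in zone_run K down l.
Proof.
move=> k_lt al; apply/flatten_mapP; exists k.
  by case: down; rewrite ?mem_rev mem_iota.
by rewrite addnC map_f.
Qed.

Lemma size_zone_run (down : bool) (l : seq nat) : size (zone_run K down l) = size l * K.
Proof.
rewrite size_flatten /shape -map_comp; set f := _ \o _.
rewrite (eq_map (g := fun=> size l)); last by move=> k; rewrite /f /= size_map.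
rewrite sumnE big_map big_const_seq count_predT iter_addn addn0.
by case: down; rewrite ?size_rev size_iota.
Qed.

Lemma size_expand :
  size (expand K c.2) = n'.+1 - t1.
Proof.
case/and5P: c_ok => n0_gt3 t1_gt1 /eqP size1 _ /and3P[base zone _].
have -> : size (expand K c.2) = size (flatten [seq r.1 | r <- c.2])
    + size (flatten [seq r.2.2 | r <- c.2]) * K.
  rewrite /expand; elim: c.2 => //= r s IHs.
  by rewrite !size_cat IHs size_zone_run mulnDl; lia.
have := perm_size base; rewrite size_cat size_iota size1.
by rewrite (perm_size zone) size_iota n_strip => <-; rewrite -addnA addKn.
Qed.

Lemma mem_strip (x : nat) : x < n'.+1 -> x \in c.1 ++ expand K c.2.
Proof.
move=> x_lt.
case/and5P: c_ok => n0_gt3 t1_gt1 size1 _ /and3P[base zone _].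
case: (ltnP x n0) => x_n0.
  have: x \in iota 0 n0 by rewrite mem_iota.
  rewrite -(perm_mem base) !mem_cat; case/orP=> [->//|].
  case/flatten_mapP=> r cr rx; apply/orP; right; apply/flatten_mapP; exists r => //.
  by rewrite mem_cat rx.
have: n0 + (x - n0) %% 4 \in iota n0 4 by rewrite mem_iota; lia.
rewrite -(perm_mem zone); case/flatten_mapP=> r cr rx.
rewrite mem_cat; apply/orP; right; apply/flatten_mapP; exists r => //.
rewrite mem_cat (_ : x = n0 + (x - n0) %% 4 + 4 * ((x - n0) %/ 4)); last by lia.
by rewrite mem_zone_run ?orbT //; lia.
Qed.

Lemma cycle_strip_succ :
  cycle (frel (strip_succ n0 K (arc_table n0 c))) c.1 /\
  cycle (frel (strip_succ n0 K (arc_table n0 c))) (expand K c.2).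
Proof.
case/and5P: c_ok => n0_gt3 t1_gt1 size1 c1 /and3P[base zone c2_ok].
split.
  by apply: sub_cycle c1 => x y /(base_arc_succ K n0_gt3) xy; apply/eqP.
by case: c.2 c2_ok => // r s /(stretches_cycle K n0_gt3).
Qed.

(** The two cycles list as many labels as there are vertices, and by [v_surj] their images reach
    every vertex, so none is repeated. *)
Lemma strip_cycles_uniq :
  uniq (map v (c.1 ++ expand K c.2)).
Proof.
apply: uniq_of_cover => [|y].
  rewrite size_map size_cat size_expand.
  case/and5P: c_ok => n0_gt3 t1_gt1 /eqP size1 _ /and3P[base _ _].
  have := perm_size base; rewrite size_cat size_iota size1 n_strip => <-.
  by rewrite -addnA addKn.
by have [x x_lt <-] := v_surj y; rewrite map_f // mem_strip.
Qed.

Lemma strip_arcs_factor : 1 < n'.+1 - t1 ->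
  two_cycle_factor t1 (n'.+1 - t1) (complete_symmetric_digraph n'.+1) strip_arcs.
Proof.
move=> t2_gt1.
case/and5P: c_ok => n0_gt3 t1_gt1 /eqP size1 _ _.
apply: two_cycle_factor_dicycles => //; rewrite ?size_map ?size_expand // -?map_cat.
  exact: strip_cycles_uniq.
by move=> y; have [x x_lt <-] := v_surj y; rewrite map_f // mem_strip.
Qed.

Lemma mem_strip_arcs (x s : nat) :
    x < n'.+1 -> nth 0 (arc_table n0 c) (label_type n0 x) = s ->
  (v x, v (arc_target n0 K x s)) \in strip_arcs.
Proof.
move=> x_lt <-; rewrite -/(strip_succ n0 K (arc_table n0 c) x).
have := strip_cycles_uniq; rewrite map_cat cat_uniq => /and3P[uniq1 _ uniq2].
have [cycle1 cycle2] := cycle_strip_succ.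
have arcP (p : seq nat) : uniq (map v p) -> cycle (frel (strip_succ n0 K (arc_table n0 c))) p ->
    x \in p -> (v x, v (strip_succ n0 K (arc_table n0 c) x)) \in dicycle (map v p).
  move=> p_uniq p_cycle px; apply/imsetP; exists (v x); first exact: map_f.
  by rewrite next_map_uniq // -(eqP (next_cycle p_cycle px)).
have := mem_strip x_lt; rewrite mem_cat inE => /orP[xc|xc]; apply/orP.
  by left; apply: arcP.
by right; apply: arcP.
Qed.

End StripVertices.

(** * Positions of the columns along the zigzags and the ladder *)

Ltac split_ifs :=
  repeat match goal with
  | |- context [if ?b then _ else _] =>
      lazymatch b with
      | context [if _ then _ else _] => fail
      | _ => destruct b eqn:?
      end
  end.

(* The columns after the extra one on the i-th zigzag: i, i + 1, i - 1, i + 2, ... modulo N. *)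
Definition zigzag (N i p : nat) : nat :=
  if odd p then (if i + 1 + p %/ 2 < N then i + 1 + p %/ 2 else i + 1 + p %/ 2 - N)
  else (if p %/ 2 <= i then i - p %/ 2 else i + N - p %/ 2).

(* The extra column [N] is placed at position [e]. *)
Definition zigzag_col (N i e P : nat) : nat :=
  let q := if e <= P then P - e else P + N.+1 - e in
  if q == 0 then N else zigzag N i q.-1.

(** Inverse of [zigzag_col]. Counted from the extra column, i sits at 1, i + k at 2 k and i - k at 2
    k + 1; [u] is a - i modulo [N]. *)
Definition zigzag_pos (N i e a : nat) : nat :=
  let u := if i <= a then a - i else a + N - i in
  let q := if a == N then 0
           else if u == 0 then 1 else if 2 * u <= N then 2 * u else 2 * (N - u) + 1 in
  if q + e <= N then q + e else q + e - N.+1.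

Definition edge_class (N a b : nat) : nat :=
  let s := if a == N then b + b else if b == N then a + a else a + b in
  if s < N then s else s - N.

Lemma zigzag_pos_lt (N i e a : nat) :
  i < N -> e <= N -> a <= N -> zigzag_pos N i e a < N.+1.
Proof. by rewrite /zigzag_pos => i_N e_N a_N; split_ifs; lia. Qed.

Lemma zigzag_posK (N i e a : nat) :
  i < N -> e <= N -> a <= N -> zigzag_col N i e (zigzag_pos N i e a) = a.
Proof.
move=> i_N e_N a_N; rewrite /zigzag_pos.
set q := (if a == N then _ else _).
have q_le : q <= N by rewrite /q; split_ifs; lia.
rewrite /zigzag_col; set P := (if q + e <= N then _ else _).
have -> : (if e <= P then P - e else P + N.+1 - e) = q.
  by rewrite /P; split_ifs; lia.
by rewrite /q /zigzag {q_le P q}; split_ifs; lia.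
Qed.

(* Moving by [d - 2] positions around a cycle of [N + 1] positions. *)
Definition cyclic_shift (N P d : nat) : nat :=
  if P + d < 2 then P + d + N - 1
  else if P + d - 2 <= N then P + d - 2 else P + d - 2 - N.+1.

(** Along the zigzag the sums of neighbours modulo [N] are always 2 i or 2 i + 1. A column other
    than the extra one has a single partner for each of these classes, so its partners are exactly
    its two neighbours. *)
Lemma zigzag_pos_adj (N i e a b : nat) :
    2 * i < N -> e <= N -> a <= N -> b <= N -> a != b ->
    edge_class N a b %/ 2 = i ->
  exists2 d, d \in [:: 1; 3] &
    cyclic_shift N (zigzag_pos N i e a) d = zigzag_pos N i e b.
Proof.
move=> i_N e_N a_N b_N ab cls.
have {cls} : edge_class N a b = 2 * i \/ edge_class N a b = 2 * i + 1 by lia.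
rewrite /edge_class /zigzag_pos /cyclic_shift.
(* These are positions counted from the extra column. Their adjacency does not involve [e], which
   only rotates them afterwards. *)
set qa := (if a == N then 0 else _); set qb := (if b == N then 0 else _) => cls.
have : [\/ qb = qa.+1, qa = qb.+1, qa = 0 /\ qb = N | qb = 0 /\ qa = N].
  by rewrite /qa /qb; case: cls; split_ifs => cls;
    solve [exfalso; lia | constructor 1; lia | constructor 2; lia
          | constructor 3; lia | constructor 4; lia].
have qa_N : qa <= N by rewrite /qa; split_ifs; lia.
have qb_N : qb <= N by rewrite /qb; split_ifs; lia.
move: qa qb qa_N qb_N {cls} => qa qb qa_N qb_N.
have N_gt0 : 0 < N by lia.
by case=> [->|->|[-> ->]|[-> ->]]; [exists 3 | exists 1 | exists 1 | exists 3];
  rewrite //; split_ifs; lia.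
Qed.

(* With h = N - 1, rung j of the ladder consists of the columns h + j and h - j modulo N.  The
   columns [N] and h sit at positions 4 and 5, between the last rung and the first one. *)
Definition rung_pos (N j : nat) : nat :=
  if 2 * j + 4 < N then 2 * j + 4 else 2 * j + 3 - N.

Definition ladder_pos (N a : nat) : nat :=
  if a == N then 4 else if a == N.-1 then 5 else
  let j := if 2 * a.+1 < N then a.+1 else N - a.+1 in
  rung_pos N j + (if 2 * a.+1 < N then j %% 2 else 1 - j %% 2).

Definition ladder_col (N P : nat) : nat :=
  let j := if 4 <= P then P %/ 2 - 2 else P %/ 2 + N.+1 %/ 2 - 2 in
  if j == 0 then (if odd P then N.-1 else N)
  else if odd P == odd j then j.-1 else N - j.+1.

(* Offset codes [d] as in [cyclic_shift]. *)
Definition ladder_step (P d : nat) : bool :=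
  match d with
  | 0 => (P != 5) && (P != 6)
  | 1 => odd P || (P == 4) || (P == 6)
  | 3 => ~~ odd P || (P == 3) || (P == 5)
  | 4 => (P != 3) && (P != 4)
  | _ => false
  end.

Lemma ladder_pos_lt (N a : nat) :
  odd N -> 6 < N -> a <= N -> ladder_pos N a < N.+1.
Proof. by rewrite /ladder_pos /rung_pos => N_odd N_gt6 a_N; split_ifs; lia. Qed.

Lemma ladder_posK (N a : nat) :
  odd N -> 6 < N -> a <= N -> ladder_col N (ladder_pos N a) = a.
Proof.
rewrite /ladder_pos /rung_pos => N_odd N_gt6 a_N; split_ifs; rewrite /ladder_col; split_ifs; lia.
Qed.

Variant ladder_pos_spec (N a : nat) : nat -> Prop :=
  | LadderExtra of a = N : ladder_pos_spec N a 4
  | LadderCenter of a.+1 = N : ladder_pos_spec N a 5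
  | LadderRung j s of 0 < j & 2 * j < N & s < 2
      & a.+1 = j /\ s = j %% 2 \/ a.+1 + j = N /\ s + j %% 2 = 1 :
      ladder_pos_spec N a (rung_pos N j + s).

Lemma ladder_posP (N a : nat) :
  odd N -> a <= N -> ladder_pos_spec N a (ladder_pos N a).
Proof.
move=> N_odd a_N; rewrite /ladder_pos.
case: eqP => [->|a_neq]; first exact: LadderExtra.
case: eqP => [a_eq|a_neq1]; first by apply: LadderCenter; lia.
case: ifP => a_half; apply: LadderRung; lia.
Qed.

(** Modulo [N], h is -1. The sum -2 joins the two columns of a rung; the sums -3 and -1 join h + j
    to h - (j + 1) and to h - (j - 1). As the columns h + j change sides from rung to rung,
    neighbouring rungs are joined on equal sides, that is, [s = t]. *)
Lemma rung_adj (N a b j s k t : nat) :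
    odd N -> 6 < N -> a.+1 < N -> b.+1 < N -> 2 * j < N -> 2 * k < N -> a != b ->
    a.+1 = j /\ s = j %% 2 \/ a.+1 + j = N /\ s + j %% 2 = 1 ->
    b.+1 = k /\ t = k %% 2 \/ b.+1 + k = N /\ t + k %% 2 = 1 ->
    N - 3 <= edge_class N a b ->
  [\/ j = k /\ s + t = 1, k = j.+1 /\ s = t | j = k.+1 /\ s = t].
Proof.
move=> N_odd N_gt6 a_lt b_lt j_lt k_lt ab [] [aj sj] [] [bk tk];
  rewrite /edge_class; split_ifs => cls.
all: first [by exfalso; lia | idtac].
all: have [jk|[jk|jk]] : j = k \/ k = j.+1 \/ j = k.+1 by lia.
all: solve [constructor 1; lia | constructor 2; lia | constructor 3; lia].
Qed.

Lemma cyclic_shift_eq (N P Q d : nat) : P <= N -> Q <= N ->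
    [\/ P + d = Q + 2, P + d = Q + 2 + N.+1 | P + d + N.+1 = Q + 2] ->
  cyclic_shift N P d = Q.
Proof. by rewrite /cyclic_shift => P_N Q_N [] PQ; split_ifs; lia. Qed.

(** The ends of a rung are one position apart and neighbouring rungs two. The exceptions in
    [ladder_step] come from the two single columns: position 4 is joined to 2, 3 and 5, and position
    5 to 4, 6 and 7. *)
Lemma ladder_pos_adj (N a b : nat) :
    odd N -> 6 < N -> a <= N -> b <= N -> a != b -> N - 3 <= edge_class N a b ->
  exists2 d, ladder_step (ladder_pos N a) d &
    cyclic_shift N (ladder_pos N a) d = ladder_pos N b.
Proof.
move=> N_odd N_gt6 a_N b_N ab cls.
have := ladder_pos_lt N_odd N_gt6 a_N; have := ladder_pos_lt N_odd N_gt6 b_N.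
case: (ladder_posP N_odd a_N) => [aN|aN|j s j_gt0 j_lt s_lt aj];
case: (ladder_posP N_odd b_N) => [bN|bN|k t k_gt0 k_lt t_lt bk] b_pos a_pos.
- by lia.
- by exists 3 => //; apply: cyclic_shift_eq => //; constructor 1.
- have k_eq : 2 * k + 1 = N by move: cls; rewrite /edge_class; split_ifs; lia.
  move: b_pos; have -> : rung_pos N k = 2 by rewrite /rung_pos; case: ifP; lia.
  move=> b_pos; exists t; first by case: t t_lt {bk b_pos} => [|[|t]].
  by apply: cyclic_shift_eq => //; constructor 1; lia.
- by exists 1 => //; apply: cyclic_shift_eq => //; constructor 1.
- by lia.
- have -> : k = 1 by move: cls; rewrite /edge_class; split_ifs; lia.
  have -> : rung_pos N 1 = 6 by rewrite /rung_pos; case: ifP; lia.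
  exists (3 + t); first by case: t t_lt {bk b_pos} => [|[|t]].
  by apply: cyclic_shift_eq => //; [lia | constructor 1; lia].
- have j_eq : 2 * j + 1 = N by move: cls; rewrite /edge_class; split_ifs; lia.
  move: a_pos; have -> : rung_pos N j = 2 by rewrite /rung_pos; case: ifP; lia.
  move=> a_pos; exists (4 - s); first by case: s s_lt {aj a_pos} => [|[|s]].
  by apply: cyclic_shift_eq => //; constructor 1; lia.
- have -> : j = 1 by move: cls; rewrite /edge_class; split_ifs; lia.
  have -> : rung_pos N 1 = 6 by rewrite /rung_pos; case: ifP; lia.
  exists (1 - s); first by case: s s_lt {aj a_pos} => [|[|s]].
  by apply: cyclic_shift_eq => //; [lia | constructor 1; lia].
have a_lt : a.+1 < N by case: aj; lia.
have b_lt : b.+1 < N by case: bk; lia.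
have adj := rung_adj N_odd N_gt6 a_lt b_lt j_lt k_lt ab aj bk cls.
clear aj bk cls; rewrite /rung_pos in a_pos b_pos *.
case: adj => -[jk st].
- exists (3 - 2 * s).
    by case: s s_lt st {a_pos} => [|[|s]] // _ _; case: ifP => j_N /=; lia.
  apply: cyclic_shift_eq => //; rewrite -jk; constructor 1; lia.
- exists 4; first by rewrite /ladder_step; case: ifP => j_N; lia.
  apply: cyclic_shift_eq => //; rewrite jk; case: ifP => j_N; case: ifP => j_N2;
    solve [constructor 1; lia | constructor 2; lia | exfalso; lia].
- exists 0; first by rewrite /ladder_step; case: ifP => j_N; lia.
  apply: cyclic_shift_eq => //; rewrite jk; case: ifP => j_N; case: ifP => j_N2;
    solve [constructor 1; lia | constructor 3; lia | exfalso; lia].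
Qed.

Lemma edge_class_lt (N a b : nat) : a <= N -> b <= N -> a != b -> edge_class N a b < N.
Proof. by rewrite /edge_class => a_N b_N ab; split_ifs; lia. Qed.

(** A zone copy is two whole columns, so adding back the offset of the copy turns the label type
    into the label itself, and the code [2 * d] becomes a move by d - 2 columns. *)
Lemma arc_target_shift (n0 K N P g d f : nat) :
    ~~ odd n0 -> 3 < n0 -> N.+1 * 2 = n0 + 4 * K -> P <= N -> g < 2 -> f < 2 -> d <= 4 ->
  arc_target n0 K (2 * P + g) (2 * (label_type n0 (2 * P + g) %/ 2) + 2 * d + f)
    = 2 * cyclic_shift N P d + f.
Proof.
move=> n0_even n0_gt3 n_N P_N g_lt f_lt d_le.
set x := 2 * P + g; rewrite /arc_target.
have -> : 2 * (label_type n0 x %/ 2) + 2 * d + f + 4 * ((x - n0) %/ 4) + (n0 + 4 * K) - 4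
   = 2 * P + 2 * d + f + (n0 + 4 * K) - 4.
  rewrite /label_type /x; case: ifP => x_n0.
    have -> : (2 * P + g - n0) %/ 4 = 0 by lia.
    by lia.
  by lia.
rewrite /cyclic_shift; case: ifP => Pd.
  by rewrite modn_small; lia.
case: ifP => Pd2.
  rewrite (_ : _ - 4 = 2 * (P + d - 2) + f + (n0 + 4 * K)); last by lia.
  by rewrite modnDr modn_small //; lia.
rewrite (_ : _ - 4 = 2 * (P + d - 2 - N.+1) + f + (n0 + 4 * K) + (n0 + 4 * K)); last by lia.
by rewrite !modnDr modn_small //; lia.
Qed.

(** * Covering the arcs between and inside columns *)

Definition arc_tables (n0 : nat) (cs : seq strip_factor) : seq (seq nat) :=
  [seq arc_table n0 c | c <- cs].

Definition covers (tabs : seq (seq nat)) (t s : nat) : bool :=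
  has (fun tab => nth 0 tab t == s) tabs.

(* All arcs from a label to the columns at the positions allowed by [step], and the inner arc of
   its own column if [inner] holds. *)
Definition covers_steps (n0 : nat) (cov : nat -> nat -> bool) (step : nat -> nat -> bool)
    (inner : bool) : bool :=
  all (fun t =>
    (inner ==> cov t (2 * (t %/ 2) + 4 + (1 - t %% 2))) &&
    all (fun d => step (t %/ 2) d ==>
      cov t (2 * (t %/ 2) + 2 * d) && cov t (2 * (t %/ 2) + 2 * d + 1)) (iota 0 5))
  (iota 0 (n0 + 4)).

Definition cyclic_step (P d : nat) : bool := (d == 1) || (d == 3).

Section Column.

Variables (n' : nat) (col pos : nat -> nat).

Definition col_vertex (x : nat) : 'I_n'.+1 := inord (2 * col (x %/ 2) + x %% 2).

Definition col_label (y : 'I_n'.+1) : nat := 2 * pos (y %/ 2) + y %% 2.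

Variable N : nat.
Hypothesis n_N : n'.+1 = N.+1 * 2.
Hypothesis pos_lt : forall a, a <= N -> pos a < N.+1.
Hypothesis posK : forall a, a <= N -> col (pos a) = a.

Lemma half_le (y : 'I_n'.+1) : y %/ 2 <= N.
Proof. by have := ltn_ord y; lia. Qed.

Lemma col_label_lt y : col_label y < n'.+1.
Proof. by rewrite /col_label; have := pos_lt (half_le y); lia. Qed.

Lemma col_vertex_pos (a : nat) (y : 'I_n'.+1) :
  y %/ 2 = a -> col_vertex (2 * pos a + y %% 2) = y.
Proof.
move=> y_a; rewrite /col_vertex.
have -> : (2 * pos a + y %% 2) %/ 2 = pos a by lia.
have -> : (2 * pos a + y %% 2) %% 2 = y %% 2 by lia.
rewrite posK; last by rewrite -y_a half_le.
by apply: val_inj; rewrite /= inordK -y_a; have := ltn_ord y; lia.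
Qed.

Lemma col_labelK y : col_vertex (col_label y) = y.
Proof. exact: col_vertex_pos. Qed.

Lemma col_vertex_surj y : exists2 x, x < n'.+1 & col_vertex x = y.
Proof. by exists (col_label y); [apply: col_label_lt | apply: col_labelK]. Qed.

Variables (n0 K : nat).
Hypothesis n_strip : n'.+1 = n0 + 4 * K.
Hypothesis n0_even : ~~ odd n0.
Hypothesis n0_gt3 : 3 < n0.

Definition strip_family (cs : seq strip_factor) : seq {set 'I_n'.+1 * 'I_n'.+1} :=
  [seq strip_arcs K c col_vertex | c <- cs].

Lemma covers_mem (t1 : nat) (cs : seq strip_factor) (x s : nat) :
    all (fun c => strip_factor_ok n0 c t1) cs -> x < n'.+1 ->
    covers (arc_tables n0 cs) (label_type n0 x) s ->
  exists2 F, F \in strip_family cs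
    & (col_vertex x, col_vertex (arc_target n0 K x s)) \in F.
Proof.
move=> /allP cs_ok x_lt; rewrite /covers has_map => /hasP[c c_cs /eqP c_s].
exists (strip_arcs K c col_vertex); first exact: map_f.
exact: mem_strip_arcs n_strip (cs_ok _ c_cs) col_vertex_surj _ _ x_lt c_s.
Qed.

Lemma label_type_lt x : label_type n0 x < n0 + 4.
Proof. by rewrite /label_type; case: ifP; lia. Qed.

Lemma covers_stepsP (cov step : nat -> nat -> bool) (inner : bool) (y z : 'I_n'.+1) :
    covers_steps n0 cov step inner -> y != z ->
    (y %/ 2 = z %/ 2 -> inner) ->
    (y %/ 2 <> z %/ 2 -> exists2 d,
       (d < 5) && step (label_type n0 (col_label y) %/ 2) d
       & cyclic_shift N (pos (y %/ 2)) d = pos (z %/ 2)) ->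
  exists2 s, cov (label_type n0 (col_label y)) s & arc_target n0 K (col_label y) s = col_label z.
Proof.
move=> /allP cov_ok yz in_col off_col.
have t_in : label_type n0 (col_label y) \in iota 0 (n0 + 4).
  by rewrite mem_iota label_type_lt.
have /andP[cov_in /allP cov_off] := cov_ok _ t_in.
have y_lt := pos_lt (half_le y).
have target d f : d <= 4 -> f < 2 ->
    arc_target n0 K (col_label y) (2 * (label_type n0 (col_label y) %/ 2) + 2 * d + f)
      = 2 * cyclic_shift N (pos (y %/ 2)) d + f.
  by move=> d_le f_lt; apply: arc_target_shift => //; lia.
have par : label_type n0 (col_label y) %% 2 = y %% 2.
  by rewrite /label_type /col_label; case: ifP; lia.
case: (eqVneq (y %/ 2) (z %/ 2)) => [yz_col|/eqP yz_col].
  move: cov_in; rewrite (in_col yz_col) /= par => cov_in.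
  exists (2 * (label_type n0 (col_label y) %/ 2) + 4 + (1 - y %% 2)) => //.
  (* The offset [d = 2] moves by no column; only the side changes. *)
  rewrite (target 2 (1 - y %% 2)) //; last by lia.
  have -> : cyclic_shift N (pos (y %/ 2)) 2 = pos (y %/ 2).
    by rewrite /cyclic_shift; split_ifs; lia.
  rewrite /col_label yz_col.
  have : val y <> val z by move=> /val_inj yz_eq; rewrite yz_eq eqxx in yz.
  by move=> /= yz_val; lia.
have [d /andP[d_lt d_step] d_shift] := off_col yz_col.
have d_in : d \in iota 0 5 by rewrite mem_iota.
move: (cov_off d d_in); rewrite d_step /= => /andP[cov0 cov1].
exists (2 * (label_type n0 (col_label y) %/ 2) + 2 * d + z %% 2).
  by case: (z %% 2) (ltn_mod z 2) => [|[|k]] //; rewrite addn0.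
by rewrite target ?d_shift ?ltn_mod.
Qed.

End Column.

(** * Ordinary zigzags and the double strip *)

Definition family_ok (n0 t1 k : nat) (cs : seq strip_factor) : bool :=
  (size cs == k) && all (fun c => strip_factor_ok n0 c t1) cs.

Definition zigzag_family (n' N K i e : nat) (cs : seq strip_factor) :=
  @strip_family n' (zigzag_col N i e) K cs.

(* An arc between base labels of one strip may be covered by a factor of another strip; [tau] lists
   pairs of positions of the same column in the two strips. *)
Definition transfer (n0 : nat) (tau : seq (nat * nat)) (tabs : seq (seq nat))
    (t s : nat) : bool :=
  [&& t < n0, 4 <= s & s < n0 + 4] &&
  has (fun p => has (fun q =>
    [&& t %/ 2 == p.1, (s - 4) %/ 2 == q.1 &
        covers tabs (2 * p.2 + t %% 2) (2 * q.2 + s %% 2 + 4)]) tau) tau.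

Section Assembly.

Variables (n' N n0 K t1 : nat).
Hypothesis n_N : n'.+1 = N.+1 * 2.
Hypothesis n_strip : n'.+1 = n0 + 4 * K.
Hypothesis n0_gt3 : 3 < n0.

Let n0_even : ~~ odd n0.
Proof. by lia. Qed.

Section Zigzag.

Variables (i e : nat).
Hypothesis i_N : 2 * i < N.
Hypothesis e_N : e <= N.

Let i_lt : i < N.
Proof. by lia. Qed.

Lemma zigzag_vertex_surj (y : 'I_n'.+1) :
  exists2 x, x < n'.+1 & @col_vertex n' (zigzag_col N i e) x = y.
Proof.
apply: (@col_vertex_surj n' (zigzag_col N i e) (zigzag_pos N i e) N n_N).
  by move=> a a_N; apply: zigzag_pos_lt.
by move=> a a_N; apply: zigzag_posK.
Qed.

Lemma zigzag_cover (cov : nat -> nat -> bool) (inner : bool) (y z : 'I_n'.+1) :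
    covers_steps n0 cov cyclic_step inner -> y != z ->
    (if y %/ 2 == z %/ 2 then inner else edge_class N (y %/ 2) (z %/ 2) %/ 2 == i) ->
  exists x s, [/\ x < n'.+1, @col_vertex n' (zigzag_col N i e) x = y,
    @col_vertex n' (zigzag_col N i e) (arc_target n0 K x s) = z
    & cov (label_type n0 x) s].
Proof.
move=> cov_ok yz yz_class.
have pos_lt a : a <= N -> zigzag_pos N i e a < N.+1.
  by move=> a_N; apply: zigzag_pos_lt.
have posK a : a <= N -> zigzag_col N i e (zigzag_pos N i e a) = a.
  by move=> a_N; apply: zigzag_posK.
have [s cov_s s_z] := @covers_stepsP n' _ N n_N pos_lt n0 K n_strip n0_even n0_gt3
  _ _ _ _ _ cov_ok yz
  (fun E => ltac:(by move: yz_class; rewrite E eqxx))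
  (fun E => ltac:(move: yz_class; case: eqP => // _ /eqP cls;
    have [|d d_in d_shift] := @zigzag_pos_adj N i e (y %/ 2) (z %/ 2) i_N e_N
      (half_le n_N y) (half_le n_N z) _ cls;
    [by apply/eqP | exists d => //; by move: d_in; rewrite !inE => /orP[] /eqP ->])).
exists (col_label (zigzag_pos N i e) y), s; split=> //.
- exact: (col_label_lt n_N pos_lt).
- exact: (col_labelK n_N posK).
- by rewrite s_z; apply: (col_labelK n_N posK).
Qed.

Lemma zigzag_mem (cs : seq strip_factor) (x s : nat) :
    all (fun c => strip_factor_ok n0 c t1) cs -> x < n'.+1 ->
    covers (arc_tables n0 cs) (label_type n0 x) s ->
  exists2 F, F \in zigzag_family n' N K i e cs
    & (@col_vertex n' (zigzag_col N i e) x,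
       @col_vertex n' (zigzag_col N i e) (arc_target n0 K x s)) \in F.
Proof.
move=> cs_ok x_lt cov.
have pos_lt a : a <= N -> zigzag_pos N i e a < N.+1 by exact: zigzag_pos_lt.
have posK a : a <= N -> zigzag_col N i e (zigzag_pos N i e a) = a by exact: zigzag_posK.
exact: (covers_mem n_N pos_lt posK n_strip cs_ok x_lt cov).
Qed.

Lemma zigzag_factor (cs : seq strip_factor) (F : {set 'I_n'.+1 * 'I_n'.+1}) :
    all (fun c => strip_factor_ok n0 c t1) cs -> 1 < n'.+1 - t1 ->
    F \in zigzag_family n' N K i e cs ->
  two_cycle_factor t1 (n'.+1 - t1) (complete_symmetric_digraph n'.+1) F.
Proof.
move=> /allP cs_ok t2_gt1 /mapP[c c_cs ->].
exact: (strip_arcs_factor n_strip (cs_ok _ c_cs) zigzag_vertex_surj).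
Qed.

End Zigzag.

Lemma label_type_base (x : nat) : label_type n0 x < n0 -> label_type n0 x = x.
Proof. by rewrite /label_type; case: ifP => //; lia. Qed.

(** A base label stands for a single vertex, so a base arc can be renamed in the other strip: [x1]
    and [y1] below are the labels there of the same two vertices. *)
Lemma transfer_cover (i0 e0 i1 e1 : nat) (tau : seq (nat * nat))
    (cs : seq strip_factor) (x s : nat) :
    2 * i1 < N -> e1 <= N ->
    {in tau, forall p, 2 * p.2 + 1 < n0 /\
       zigzag_col N i0 e0 p.1 = zigzag_col N i1 e1 p.2} ->
    all (fun c => strip_factor_ok n0 c t1) cs ->
    x < n'.+1 -> transfer n0 tau (arc_tables n0 cs) (label_type n0 x) s ->
  exists2 F, F \in zigzag_family n' N K i1 e1 cs
    & (@col_vertex n' (zigzag_col N i0 e0) x,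
       @col_vertex n' (zigzag_col N i0 e0) (arc_target n0 K x s)) \in F.
Proof.
move=> i1_N e1_N tau_col cs_ok x_lt /andP[/and3P[t_lt s_ge s_lt]].
have x_type := label_type_base t_lt; rewrite x_type in t_lt *.
case/hasP=> -[p1 p2] p_tau /hasP[[q1 q2] q_tau /and3P[/= /eqP x_p /eqP s_q cov]].
have /= [p_lt p_col] := tau_col _ p_tau; have /= [q_lt q_col] := tau_col _ q_tau.
have base_target y z : y < n0 -> z < n0 -> arc_target n0 K y (z + 4) = z.
  move=> y_lt z_lt; rewrite /arc_target (_ : (y - n0) %/ 4 = 0); last by lia.
  rewrite (_ : _ - 4 = z + (n0 + 4 * K)); last by lia.
  by rewrite modnDr modn_small; lia.
pose x1 := 2 * p2 + x %% 2; pose y1 := 2 * q2 + s %% 2.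
have x1_lt : x1 < n0 by rewrite /x1; lia.
have y1_lt : y1 < n0 by rewrite /y1; lia.
have type_x1 : label_type n0 x1 = x1 by rewrite /label_type x1_lt.
have [||F F_in F_arc] := @zigzag_mem i1 e1 i1_N e1_N cs x1 (y1 + 4) cs_ok.
- by rewrite n_strip; lia.
- by rewrite type_x1.
exists F => //; move: F_arc.
rewrite base_target // (_ : s = s - 4 + 4); last by lia.
rewrite base_target //; last by lia.
congr (_ \in F); congr (_, _); apply: val_inj; rewrite /col_vertex.
  rewrite x_p p_col /x1 (_ : (2 * p2 + x %% 2) %/ 2 = p2); last by lia.
  by rewrite (_ : (2 * p2 + x %% 2) %% 2 = x %% 2); last by lia.
rewrite s_q q_col /y1 (_ : (2 * q2 + s %% 2) %/ 2 = q2); last by lia.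
by rewrite (_ : (2 * q2 + s %% 2) %% 2 = (s - 4) %% 2); last by lia.
Qed.

Definition ordinary_ok (cs : seq strip_factor) : bool :=
  family_ok n0 t1 4 cs && covers_steps n0 (covers (arc_tables n0 cs)) cyclic_step false.

Definition ordinary_families (r : nat) (cs : seq strip_factor) :=
  flatten [seq zigzag_family n' N K i 0 cs | i <- iota 0 r].

Section Ordinary.

Variables (r : nat) (cs : seq strip_factor).
Hypothesis r_N : 2 * r <= N.
Hypothesis cs_ok : ordinary_ok cs.

Lemma size_ordinary : size (ordinary_families r cs) = 4 * r.
Proof.
case/andP: cs_ok => /andP[/eqP cs_size _] _.
suff size_from k m : size (flatten [seq zigzag_family n' N K i 0 cs | i <- iota m k]) = 4 * k.
  exact: size_from.
by elim: k m => //= k IHk m; rewrite size_cat IHk size_map cs_size mulnS.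
Qed.

Lemma ordinary_factor (F : {set 'I_n'.+1 * 'I_n'.+1}) :
    1 < n'.+1 - t1 -> F \in ordinary_families r cs ->
  two_cycle_factor t1 (n'.+1 - t1) (complete_symmetric_digraph n'.+1) F.
Proof.
case/andP: cs_ok => /andP[_ all_ok] _ t2_gt1 /flatten_mapP[i].
by rewrite mem_iota => i_r; apply: zigzag_factor => //; lia.
Qed.

Lemma ordinary_cover (y z : 'I_n'.+1) :
    y %/ 2 != z %/ 2 -> edge_class N (y %/ 2) (z %/ 2) < 2 * r ->
  exists2 F, F \in ordinary_families r cs & (y, z) \in F.
Proof.
move=> yz cls; case/andP: cs_ok => /andP[_ all_ok] steps.
set i := edge_class N (y %/ 2) (z %/ 2) %/ 2 in cls.
have i_r : i < r by rewrite /i; lia.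
have i_N : 2 * i < N by lia.
have y_z : y != z by apply: contra yz => /eqP ->.
have [|x [s [x_lt <- <- cov]]] :=
  @zigzag_cover i 0 i_N (leq0n N) (covers (arc_tables n0 cs)) false y z steps y_z.
  by rewrite (negPf yz).
have [F F_in F_arc] := zigzag_mem i_N (leq0n N) all_ok x_lt cov.
exists F => //; apply/flatten_mapP; exists i => //.
by rewrite mem_iota.
Qed.

End Ordinary.

Section DoubleStrip.

Variables (r e0 e1 : nat) (tau : seq (nat * nat)) (cs cs0 cs1 : seq strip_factor).

Definition swap_pairs (s : seq (nat * nat)) := [seq (p.2, p.1) | p <- s].

Definition double_steps_ok (tabs0 tabs1 : seq (seq nat)) : bool :=
  covers_steps n0
    (fun t s => covers tabs0 t s || transfer n0 tau tabs1 t s) cyclic_step true &&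
  covers_steps n0
    (fun t s => covers tabs1 t s || transfer n0 (swap_pairs tau) tabs0 t s)
    cyclic_step false.

Definition double_strip_ok : bool :=
  [&& ordinary_ok cs, family_ok n0 t1 5 cs0, family_ok n0 t1 4 cs1 &
      double_steps_ok (arc_tables n0 cs0) (arc_tables n0 cs1)].

Hypothesis N_r : N = 2 * r + 4.
Hypothesis e0_N : e0 <= N.
Hypothesis e1_N : e1 <= N.
Hypothesis tau_col : {in tau, forall p,
  [/\ 2 * p.1 + 1 < n0, 2 * p.2 + 1 < n0 &
      zigzag_col N r e0 p.1 = zigzag_col N r.+1 e1 p.2]}.
Hypothesis data_ok : double_strip_ok.
Hypothesis t2_gt1 : 1 < n'.+1 - t1.

(** Zigzags below [r] take four factors each, zigzag [r] takes five together with the inner arcs,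
    and zigzag [r.+1] takes four. As n = 4 r + 10, the total 4 r + 9 is n - 1. *)
Lemma double_strip_factorization :
  exists P, two_cycle_factorization t1 (n'.+1 - t1) (complete_symmetric_digraph n'.+1) P.
Proof.
case/and4P: data_ok => ord_ok /andP[/eqP size0 ok0] /andP[/eqP size1 ok1] /andP[steps0 steps1].
have r_N : 2 * r < N by lia.
have r1_N : 2 * r.+1 < N by lia.
pose Fs := ordinary_families r cs ++
  (zigzag_family n' N K r e0 cs0 ++ zigzag_family n' N K r.+1 e1 cs1).
exists [set F in Fs]; apply: factorization_of_cover.
- by lia.
- rewrite !size_cat (size_ordinary _ ord_ok) !size_map size0 size1; lia.
- move=> F; rewrite !mem_cat => /or3P[].
  + exact: (ordinary_factor (ltnW r_N) ord_ok t2_gt1).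
  + exact: zigzag_factor.
  + exact: zigzag_factor.
move=> y z yz.
have in_ord F : F \in ordinary_families r cs -> F \in Fs by rewrite !mem_cat => ->.
have in0 F : F \in zigzag_family n' N K r e0 cs0 -> F \in Fs.
  by rewrite !mem_cat => ->; rewrite orbT.
have in1 F : F \in zigzag_family n' N K r.+1 e1 cs1 -> F \in Fs.
  by rewrite !mem_cat => ->; rewrite !orbT.
have tau0 : {in tau, forall p, 2 * p.2 + 1 < n0 /\
    zigzag_col N r e0 p.1 = zigzag_col N r.+1 e1 p.2} by move=> p /tau_col[].
have tau1 : {in swap_pairs tau, forall p, 2 * p.2 + 1 < n0 /\
    zigzag_col N r.+1 e1 p.1 = zigzag_col N r e0 p.2}.
  by move=> _ /mapP[p /tau_col[p1 p2 p_col] ->]; split.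
have cover0 : (if y %/ 2 == z %/ 2 then true
               else edge_class N (y %/ 2) (z %/ 2) %/ 2 == r) ->
    exists2 F, F \in Fs & (y, z) \in F.
  case/(zigzag_cover r_N e0_N steps0 yz)=> x [s [x_lt <- <- /orP[cov|cov]]].
    by have [F /in0 FFs] := zigzag_mem r_N e0_N ok0 x_lt cov; exists F.
  by have [F /in1 FFs] := transfer_cover r1_N e1_N tau0 ok1 x_lt cov; exists F.
have cover1 : (if y %/ 2 == z %/ 2 then false
               else edge_class N (y %/ 2) (z %/ 2) %/ 2 == r.+1) ->
    exists2 F, F \in Fs & (y, z) \in F.
  case/(zigzag_cover r1_N e1_N steps1 yz)=> x [s [x_lt <- <- /orP[cov|cov]]].
    by have [F /in1 FFs] := zigzag_mem r1_N e1_N ok1 x_lt cov; exists F.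
  by have [F /in0 FFs] := transfer_cover r_N e0_N tau1 ok0 x_lt cov; exists F.
case: (eqVneq (y %/ 2) (z %/ 2)) => yz_col; first by apply: cover0; rewrite yz_col eqxx.
have cls_lt := edge_class_lt (half_le n_N y) (half_le n_N z) yz_col.
case: (ltnP (edge_class N (y %/ 2) (z %/ 2)) (2 * r)) => cls_r.
  by have [F /in_ord FFs] := ordinary_cover (ltnW r_N) ord_ok yz_col cls_r; exists F.
have [cls|cls] : edge_class N (y %/ 2) (z %/ 2) %/ 2 = r \/
    edge_class N (y %/ 2) (z %/ 2) %/ 2 = r.+1.
  move: (edge_class _ _ _) cls_lt cls_r N_r => k; clear; lia.
  by apply: cover0; rewrite (negPf yz_col) cls.
by apply: cover1; rewrite (negPf yz_col) cls.
Qed.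

End DoubleStrip.

End Assembly.

(** * The ladder *)

Definition ladder_ok (n0 t1 : nat) (ord cs : seq strip_factor) : bool :=
  [&& ordinary_ok n0 t1 ord, family_ok n0 t1 7 cs &
      covers_steps n0 (covers (arc_tables n0 cs)) ladder_step true].

(** Beyond position 6 [ladder_step] depends only on the parity of the position, and [label_type]
    moves a zone label by whole copies, hence by an even number of positions. *)
Lemma ladder_step_type (n0 P g d : nat) : 4 %| n0 -> 14 < n0 -> g < 2 ->
  ladder_step P d -> ladder_step (label_type n0 (2 * P + g) %/ 2) d.
Proof.
move=> n0_4 n0_gt g_lt; rewrite /label_type; case: ifP => P_n0.
  by have -> : (2 * P + g) %/ 2 = P by lia.
set T := _ %/ 2; have T_P : odd T = odd P by rewrite /T; lia.
have T_ge : 6 < T by rewrite /T; lia.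
have P_ge : 6 < P by lia.
case: d => [|[|[|[|[|d]]]]] //=; rewrite ?T_P; lia.
Qed.

Section LadderCase.

Variables (n' N n0 K t1 r : nat) (ord cs : seq strip_factor).
Hypothesis n_N : n'.+1 = N.+1 * 2.
Hypothesis n_strip : n'.+1 = n0 + 4 * K.
Hypothesis n0_gt : 14 < n0.
Hypothesis n0_4 : 4 %| n0.
Hypothesis N_r : N = 2 * r + 3.
Hypothesis data_ok : ladder_ok n0 t1 ord cs.
Hypothesis t2_gt1 : 1 < n'.+1 - t1.

(** Classes below [2 * r] go to ordinary zigzags; the last three classes and the inner arcs go to
    the seven ladder factors. As n = 4 r + 8, the total 4 r + 7 is n - 1. *)
Lemma ladder_factorization :
  exists P, two_cycle_factorization t1 (n'.+1 - t1) (complete_symmetric_digraph n'.+1) P.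
Proof.
case/and3P: data_ok => ord_ok /andP[/eqP cs_size cs_ok] steps.
have n0_gt3 : 3 < n0 by lia.
have n0_even : ~~ odd n0 by lia.
have r_N : 2 * r <= N by lia.
have N_odd : odd N by lia.
have N_gt6 : 6 < N by lia.
have pos_lt a : a <= N -> ladder_pos N a < N.+1 by exact: ladder_pos_lt.
have posK a : a <= N -> ladder_col N (ladder_pos N a) = a by exact: ladder_posK.
pose Fs := ordinary_families n' N K r ord ++ strip_family n' (ladder_col N) K cs.
exists [set F in Fs]; apply: factorization_of_cover.
- by lia.
- rewrite size_cat (size_ordinary _ _ _ _ ord_ok) size_map cs_size; lia.
- move=> F; rewrite mem_cat => /orP[].
    exact: (ordinary_factor n_N n_strip n0_gt3 r_N ord_ok t2_gt1).
  case/mapP=> c c_cs ->.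
  exact: (strip_arcs_factor n_strip (allP cs_ok _ c_cs) (col_vertex_surj n_N pos_lt posK)).
move=> y z yz.
case: (boolP ((y %/ 2 != z %/ 2) && (edge_class N (y %/ 2) (z %/ 2) < 2 * r))).
  case/andP=> yz_col cls.
  have [F F_in F_arc] := ordinary_cover n_N n_strip n0_gt3 r_N ord_ok yz_col cls.
  by exists F => //; rewrite mem_cat F_in.
rewrite negb_and negbK => far.
have [//||s cov s_z] := covers_stepsP n_N pos_lt n_strip n0_even n0_gt3 steps yz.
  move=> /eqP yz_col; rewrite (negPf yz_col) /= -leqNgt in far.
  have cls : N - 3 <= edge_class N (y %/ 2) (z %/ 2) by lia.
  have [d d_step d_shift] :=
    ladder_pos_adj N_odd N_gt6 (half_le n_N y) (half_le n_N z) yz_col cls.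
  exists d => //; rewrite ladder_step_type ?andbT //; last by lia.
  by case: d d_step {d_shift} => [|[|[|[|[|d]]]]].
have [F F_in F_arc] :=
  covers_mem n_N pos_lt posK n_strip cs_ok (col_label_lt n_N pos_lt y) cov.
exists F; first by rewrite mem_cat F_in orbT.
by move: F_arc; rewrite s_z !(col_labelK n_N posK).
Qed.

End LadderCase.

(** * Factorizations given by an explicit list *)

(* Each pair lists the two cycles of a factor. *)
Definition explicit_ok (n t1 : nat) (s : seq (seq nat * seq nat)) : bool :=
  [&& size s == n.-1,
      all (fun c => [&& size c.1 == t1, size c.2 == n - t1 & perm_eq (c.1 ++ c.2) (iota 0 n)]) s &
      all (fun x => all (fun y => (x == y) ||
        has (fun c => next (if x \in c.1 then c.1 else c.2) x == y) s) (iota 0 n)) (iota 0 n)].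

Lemma explicit_factorization (n' t1 : nat) (s : seq (seq nat * seq nat)) :
    explicit_ok n'.+1 t1 s -> 1 < t1 -> 1 < n'.+1 - t1 ->
  exists P, two_cycle_factorization t1 (n'.+1 - t1) (complete_symmetric_digraph n'.+1) P.
Proof.
case/and3P=> /eqP s_size /allP s_ok /allP s_cover t1_gt1 t2_gt1.
pose v (x : nat) : 'I_n'.+1 := inord x.
pose arcs (c : seq nat * seq nat) := dicycle (map v c.1) :|: dicycle (map v c.2).
have cover c (y : 'I_n'.+1) : c \in s -> val y \in c.1 ++ c.2.
  by case/s_ok/and3P=> _ _ /perm_mem ->; rewrite mem_iota /= ltn_ord.
have c_uniq c : c \in s -> uniq (map v (c.1 ++ c.2)).
  move=> cs; apply: uniq_of_cover => [|y].
    by have /s_ok/and3P[_ _ /perm_size] := cs; rewrite size_map size_iota => ->.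
  by rewrite -(inord_val y) map_f // cover.
exists [set F in [seq arcs c | c <- s]]; apply: factorization_of_cover.
- by lia.
- by rewrite size_map s_size.
- move=> F /mapP[c cs ->]; have /s_ok/and3P[/eqP size1 /eqP size2 _] := cs.
  apply: two_cycle_factor_dicycles; rewrite ?size_map -?map_cat //; first exact: c_uniq.
  by move=> y; rewrite -(inord_val y) map_f // cover.
move=> y z yz.
have in_iota (x : 'I_n'.+1) : val x \in iota 0 n'.+1 by rewrite mem_iota ltn_ord.
have := allP (s_cover _ (in_iota y)) _ (in_iota z).
have /negPf -> : val y != val z by apply: contra yz => /eqP/val_inj ->.
case/hasP=> c cs /eqP y_z; exists (arcs c); first exact: map_f.
have := c_uniq c cs; rewrite map_cat cat_uniq => /and3P[uniq1 _ uniq2].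
rewrite -(inord_val y) -(inord_val z) -y_z inE.
case: ifP => yc; apply/orP; [left | right]; apply/imsetP; exists (v (val y)).
- exact: map_f.
- by rewrite next_map_uniq.
- by have := cover c y cs; rewrite mem_cat yc => /(map_f v).
- by have := cover c y cs; rewrite mem_cat yc => /= yc2; rewrite next_map_uniq.
Qed.

(** * The small factorizations and their finite checks *)

(* In the names below the first number is the length of the short cycles and the second one the
   number of base labels. *)
Definition ordinary_4_14 : seq strip_factor :=
  [:: ([:: 2; 4; 6; 5],
     [:: ([:: 0; 3; 1], (true, [:: 17; 15]));
         ([:: 13; 11; 9; 7; 8; 10; 12], (false, [:: 14; 16]))]);
    ([:: 2; 5; 6; 4],
     [:: ([:: 1; 3; 0], (true, [:: 16; 14]));
         ([:: 12; 10; 8; 7; 9; 11; 13], (false, [:: 15; 17]))]);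
    ([:: 3; 4; 7; 5],
     [:: ([:: 1; 2; 0], (true, [:: 17; 14]));
         ([:: 13; 10; 9; 6; 8; 11; 12], (false, [:: 15; 16]))]);
    ([:: 3; 5; 7; 4],
     [:: ([:: 0; 2; 1], (true, [:: 16; 15]));
         ([:: 12; 11; 8; 6; 9; 10; 13], (false, [:: 14; 17]))])].

Definition ordinary_4_16 : seq strip_factor :=
  [:: ([:: 2; 4; 6; 5],
     [:: ([:: 0; 3; 1], (true, [:: 19; 17]));
         ([:: 15; 13; 11; 9; 7; 8; 10; 12; 14], (false, [:: 16; 18]))]);
    ([:: 2; 5; 6; 4],
     [:: ([:: 1; 3; 0], (true, [:: 18; 16]));
         ([:: 14; 12; 10; 8; 7; 9; 11; 13; 15], (false, [:: 17; 19]))]);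
    ([:: 3; 4; 7; 5],
     [:: ([:: 0; 2; 1], (true, [:: 18; 17]));
         ([:: 14; 13; 10; 9; 6; 8; 11; 12; 15], (false, [:: 16; 19]))]);
    ([:: 3; 5; 7; 4],
     [:: ([:: 1; 2; 0], (true, [:: 19; 16]));
         ([:: 15; 12; 11; 8; 6; 9; 10; 13; 14], (false, [:: 17; 18]))])].

Definition ordinary_6_18 : seq strip_factor :=
  [:: ([:: 2; 4; 6; 8; 7; 5],
     [:: ([:: 0; 3; 1], (true, [:: 21; 19]));
         ([:: 17; 15; 13; 11; 9; 10; 12; 14; 16], (false, [:: 18; 20]))]);
    ([:: 2; 5; 7; 8; 6; 4],
     [:: ([:: 1; 3; 0], (true, [:: 20; 18]));
         ([:: 16; 14; 12; 10; 9; 11; 13; 15; 17], (false, [:: 19; 21]))]);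
    ([:: 3; 4; 7; 9; 6; 5],
     [:: ([:: 0; 2; 1], (true, [:: 20; 19]));
         ([:: 16; 15; 12; 11; 8; 10; 13; 14; 17], (false, [:: 18; 21]))]);
    ([:: 3; 5; 6; 9; 7; 4],
     [:: ([:: 1; 2; 0], (true, [:: 21; 18]));
         ([:: 17; 14; 13; 10; 8; 11; 12; 15; 16], (false, [:: 19; 20]))])].

Definition ordinary_6_16 : seq strip_factor :=
  [:: ([:: 2; 4; 6; 8; 7; 5],
     [:: ([:: 0; 3; 1], (true, [:: 19; 17]));
         ([:: 15; 13; 11; 9; 10; 12; 14], (false, [:: 16; 18]))]);
    ([:: 2; 5; 7; 8; 6; 4],
     [:: ([:: 1; 3; 0], (true, [:: 18; 16]));
         ([:: 14; 12; 10; 9; 11; 13; 15], (false, [:: 17; 19]))]);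
    ([:: 3; 4; 7; 9; 6; 5],
     [:: ([:: 1; 2; 0], (true, [:: 19; 16]));
         ([:: 15; 12; 11; 8; 10; 13; 14], (false, [:: 17; 18]))]);
    ([:: 3; 5; 6; 9; 7; 4],
     [:: ([:: 0; 2; 1], (true, [:: 18; 17]));
         ([:: 14; 13; 10; 8; 11; 12; 15], (false, [:: 16; 19]))])].

Definition first_strip_4_14 : seq strip_factor :=
  [:: ([:: 8; 11; 13; 10],
     [:: ([:: 0; 3; 5; 2; 1; 4; 7; 9; 6; 12], (false, [:: 14; 15; 17; 16]))]);
    ([:: 6; 9; 7; 8],
     [:: ([:: 1; 3; 4; 2; 5; 0], (true, [:: 17; 14]));
         ([:: 13; 11; 10; 12], (false, [:: 15; 16]))]);
    ([:: 4; 6; 5; 7],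
     [:: ([:: 0; 2; 3; 1], (true, [:: 16; 15]));
         ([:: 12; 11; 8; 9; 10; 13], (false, [:: 14; 17]))]);
    ([:: 9; 11; 12; 10],
     [:: ([:: 1; 2; 4; 3; 0; 5; 6; 8; 7; 13], (false, [:: 15; 14; 16; 17]))]);
    ([:: 8; 10; 11; 9],
     [:: ([:: 13; 7; 5; 3; 2; 0], (true, [:: 16; 14]));
         ([:: 12; 6; 4; 1], (true, [:: 17; 15]))])].

Definition second_strip_4_14 : seq strip_factor :=
  [:: ([:: 2; 4; 3; 5],
     [:: ([:: 0; 1], (true, [:: 17; 15]));
         ([:: 13; 11; 9; 6; 7; 8; 10; 12], (false, [:: 14; 16]))]);
    ([:: 2; 5; 3; 4],
     [:: ([:: 1; 0], (true, [:: 16; 14]));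
         ([:: 12; 11; 8; 7; 6; 9; 10; 13], (false, [:: 15; 17]))]);
    ([:: 4; 7; 5; 6],
     [:: ([:: 1; 3; 2; 0], (true, [:: 17; 14]));
         ([:: 13; 10; 8; 9; 11; 12], (false, [:: 15; 16]))]);
    ([:: 4; 6; 5; 7],
     [:: ([:: 0; 2; 3; 1], (true, [:: 16; 15]));
         ([:: 12; 10; 9; 8; 11; 13], (false, [:: 14; 17]))])].

Definition first_strip_6_18 : seq strip_factor :=
  [:: ([:: 10; 11; 12; 14; 15; 13],
     [:: ([:: 0; 2; 5; 9; 8; 7; 17], (false, [:: 19; 21]));
         ([:: 1; 3; 4; 6; 16], (false, [:: 18; 20]))]);
    ([:: 4; 7; 6; 9; 10; 8],
     [:: ([:: 1; 5; 2; 3; 0], (true, [:: 21; 18]));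
         ([:: 17; 15; 12; 11; 13; 14; 16], (false, [:: 19; 20]))]);
    ([:: 7; 9; 11; 10; 12; 13],
     [:: ([:: 0; 3; 5; 8; 6; 4; 2; 1], (true, [:: 20; 19]));
         ([:: 16; 15; 14; 17], (false, [:: 18; 21]))]);
    ([:: 6; 12; 15; 17; 14; 13],
     [:: ([:: 16; 11; 8; 10; 9; 7; 5; 3; 1; 2; 4; 0], (true, [:: 20; 21; 19; 18]))]);
    ([:: 10; 13; 15; 16; 14; 12],
     [:: ([:: 17; 6; 5; 7; 8; 11; 9; 4; 3; 2; 0; 1], (true, [:: 21; 20; 18; 19]))])].

Definition second_strip_6_18 : seq strip_factor :=
  [:: ([:: 3; 8; 7; 4; 6; 5],
     [:: ([:: 0; 2; 1], (true, [:: 21; 19]));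
         ([:: 17; 15; 13; 11; 9; 10; 12; 14; 16], (false, [:: 18; 20]))]);
    ([:: 2; 5; 6; 8; 4; 3],
     [:: ([:: 1; 0], (true, [:: 20; 18]));
         ([:: 16; 15; 12; 11; 10; 9; 7; 13; 14; 17], (false, [:: 19; 21]))]);
    ([:: 4; 7; 5; 8; 9; 6],
     [:: ([:: 1; 2; 3; 0], (true, [:: 21; 18]));
         ([:: 17; 14; 12; 10; 11; 13; 15; 16], (false, [:: 19; 20]))]);
    ([:: 2; 4; 5; 7; 6; 9],
     [:: ([:: 0; 3; 1], (true, [:: 20; 19]));
         ([:: 16; 14; 13; 10; 8; 11; 12; 15; 17], (false, [:: 18; 21]))])].

Definition ladder_4_16 : seq strip_factor :=
  [:: ([:: 10; 14; 11; 12],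
     [:: ([:: 3; 1; 5; 7; 4; 8; 9; 6; 2; 0], (true, [:: 17; 18; 16]));
         ([:: 13; 15], (false, [:: 19]))]);
    ([:: 0; 3; 6; 4],
     [:: ([:: 2; 7; 9; 11; 13; 10; 8; 5; 1], (true, [:: 16; 19; 17]));
         ([:: 12; 15; 14], (false, [:: 18]))]);
    ([:: 7; 8; 10; 9],
     [:: ([:: 1; 4; 5; 6; 3; 0; 2], (true, [:: 19; 16; 18]));
         ([:: 15; 11; 14; 12; 13], (false, [:: 17]))]);
    ([:: 9; 10; 13; 11],
     [:: ([:: 2; 3; 7; 6; 5; 8; 4; 1; 0], (true, [:: 16]));
         ([:: 12; 14; 15], (false, [:: 18; 17; 19]))]);
    ([:: 10; 15; 12; 11],
     [:: ([:: 0; 5; 4; 6; 9; 8; 7; 2; 1; 3], (true, [:: 18; 19]));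
         ([:: 14; 13], (false, [:: 16; 17]))]);
    ([:: 4; 7; 5; 9],
     [:: ([:: 0; 1], (true, [:: 17]));
         ([:: 13; 14], (false, [:: 19; 18]));
         ([:: 3; 2; 6; 8; 11; 15; 10; 12], (false, [:: 16]))]);
    ([:: 0; 4; 9; 5],
     [:: ([:: 1; 2], (true, [:: 18]));
         ([:: 14; 10; 11; 8; 6; 7; 3], (true, [:: 19]));
         ([:: 15; 13; 12], (false, [:: 17; 16]))])].

Definition ladder_6_16 : seq strip_factor :=
  [:: ([:: 4; 9; 10; 14; 11; 8],
     [:: ([:: 3; 6; 7; 2; 1; 5; 0], (true, [:: 17; 18; 16]));
         ([:: 13; 12; 15], (false, [:: 19]))]);
    ([:: 4; 7; 8; 5; 9; 6],
     [:: ([:: 0; 1; 3; 2], (true, [:: 18]));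
         ([:: 14; 12; 11; 15; 10; 13], (false, [:: 16; 19; 17]))]);
    ([:: 0; 3; 7; 6; 5; 4],
     [:: ([:: 1; 2], (true, [:: 19; 16; 18]));
         ([:: 15; 11; 9; 8; 10; 12; 14; 13], (false, [:: 17]))]);
    ([:: 1; 4; 8; 6; 9; 5],
     [:: ([:: 2; 7; 3; 0], (true, [:: 16]));
         ([:: 12; 13; 10; 11; 14; 15], (false, [:: 18; 17; 19]))]);
    ([:: 0; 5; 7; 4; 6; 2],
     [:: ([:: 3; 1], (true, [:: 16; 17]));
         ([:: 12; 10; 8; 9; 11; 13; 15; 14], (false, [:: 19; 18]))]);
    ([:: 4; 5; 6; 8; 7; 9],
     [:: ([:: 1; 0; 2; 3], (true, [:: 18; 19]));
         ([:: 14; 10; 15; 13; 11; 12], (false, [:: 17; 16]))]);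
    ([:: 5; 8; 11; 10; 9; 7],
     [:: ([:: 0; 4; 1], (true, [:: 17]));
         ([:: 13; 14], (false, [:: 18]));
         ([:: 2; 6; 3], (true, [:: 19]));
         ([:: 15; 12], (false, [:: 16]))])].

(* Positions of the same column in the two strips.  The cuts of the two strips are one column
   apart, so one base column is in a different place relative to the zone and is missing here. *)
Definition common_columns : seq (nat * nat) :=
  [:: (0, 0); (2, 1); (3, 4); (4, 2); (5, 6); (6, 3); (7, 8); (8, 5)].

Definition factors_6_8 : seq (seq nat * seq nat) :=
  [:: ([:: 3; 12; 13; 7; 9; 10], [:: 0; 8; 11; 4; 6; 5; 2; 1]);
      ([:: 4; 7; 8; 10; 13; 12], [:: 0; 5; 11; 1; 2; 9; 6; 3]);
      ([:: 1; 5; 10; 4; 9; 12], [:: 0; 3; 8; 13; 6; 7; 11; 2]);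
      ([:: 1; 9; 2; 12; 10; 8], [:: 0; 4; 5; 3; 6; 11; 7; 13]);
      ([:: 0; 10; 5; 7; 3; 4], [:: 1; 11; 12; 2; 6; 13; 8; 9]);
      ([:: 0; 13; 9; 3; 1; 7], [:: 2; 8; 4; 10; 11; 5; 12; 6]);
      ([:: 0; 6; 12; 9; 13; 5], [:: 1; 4; 2; 3; 11; 8; 7; 10]);
      ([:: 0; 9; 5; 6; 1; 8], [:: 2; 13; 4; 11; 3; 10; 12; 7]);
      ([:: 0; 2; 10; 7; 12; 11], [:: 1; 6; 9; 8; 3; 5; 4; 13]);
      ([:: 0; 1; 12; 3; 7; 6], [:: 2; 5; 13; 11; 10; 9; 4; 8]);
      ([:: 1; 3; 13; 10; 2; 7], [:: 0; 11; 6; 4; 12; 8; 5; 9]);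
      ([:: 2; 4; 3; 9; 11; 13], [:: 0; 7; 5; 1; 10; 6; 8; 12]);
      ([:: 0; 12; 5; 8; 6; 10], [:: 1; 13; 3; 2; 11; 9; 7; 4])].
(** A base of 14 labels has only the positions 0 to 6, which leaves the first six pairs. *)
Lemma double_strip_4_14_ok : double_strip_ok 14 4 (take 6 common_columns)
  ordinary_4_14 first_strip_4_14 second_strip_4_14.
Proof. by vm_compute. Qed.

Lemma double_strip_6_18_ok : double_strip_ok 18 6 common_columns
  ordinary_6_18 first_strip_6_18 second_strip_6_18.
Proof. by vm_compute. Qed.

Lemma ladder_4_16_ok : ladder_ok 16 4 ordinary_4_16 ladder_4_16.
Proof. by vm_compute. Qed.

Lemma ladder_6_16_ok : ladder_ok 16 6 ordinary_6_16 ladder_6_16.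
Proof. by vm_compute. Qed.

Lemma factors_6_8_ok : explicit_ok 14 6 factors_6_8.
Proof. by vm_compute. Qed.

(** With the extra column at positions 2 and 1, the first strip reads r, r + 1, r - 1, r + 2, ...
    from position 3 and the second r + 1, r + 2, r, r + 3, ... from position 2; equal entries are
    paired. Position 0 holds column 2 r + 3 in both. *)
Lemma common_columnsP (r : nat) : 0 < r ->
  {in common_columns, forall p,
    zigzag_col (2 * r + 4) r 2 p.1 = zigzag_col (2 * r + 4) r.+1 1 p.2}.
Proof.
move=> r_gt0.
suff /allP h : all (fun p => zigzag_col (2 * r + 4) r 2 p.1
                     == zigzag_col (2 * r + 4) r.+1 1 p.2) common_columns.
  by move=> p /h/eqP.
rewrite /= /zigzag_col /zigzag /=.
rewrite !andbT.
by do ![apply/andP; split]; apply/eqP; split_ifs; lia.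
Qed.

(** * The cases by n modulo 4 *)

Lemma double_strip_case (n' n0 t1 : nat) (tau : seq (nat * nat))
    (cs cs0 cs1 : seq strip_factor) :
    13 < n0 -> n0 %% 4 = 2 -> n'.+1 %% 4 = 2 -> n0 <= n'.+1 -> 1 < n'.+1 - t1 ->
    all (fun p => (2 * p.1 + 1 < n0) && (2 * p.2 + 1 < n0)) tau ->
    {subset tau <= common_columns} -> double_strip_ok n0 t1 tau cs cs0 cs1 ->
  exists P, two_cycle_factorization t1 (n'.+1 - t1) (complete_symmetric_digraph n'.+1) P.
Proof.
move=> n0_gt n0_4 n_4 n0_n t2_gt1 /allP tau_lt tau_sub data_ok.
(* Solves n = 2 (N + 1) with N = 2 r + 4; [K] may be 0. *)
pose r := (n'.+1 - 10) %/ 4; pose K := (n'.+1 - n0) %/ 4.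
have [n_N n_strip r_gt0] : [/\ n'.+1 = (2 * r + 4).+1 * 2, n'.+1 = n0 + 4 * K & 0 < r].
  by rewrite /r /K; split; lia.
apply: (double_strip_factorization (e0 := 2) (e1 := 1) n_N n_strip
  _ (erefl _) _ _ _ data_ok t2_gt1).
- exact: leq_trans n0_gt.
- by rewrite !addnS.
- by rewrite addnS.
move=> p p_tau; have /andP[p1_lt p2_lt] := tau_lt p p_tau.
by split=> //; apply: common_columnsP r_gt0 _ (tau_sub p p_tau).
Qed.

Lemma ladder_case (n' t1 : nat) (ord cs : seq strip_factor) :
    n'.+1 %% 4 = 0 -> 15 < n'.+1 -> 1 < n'.+1 - t1 -> ladder_ok 16 t1 ord cs ->
  exists P, two_cycle_factorization t1 (n'.+1 - t1) (complete_symmetric_digraph n'.+1) P.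
Proof.
move=> n_4 n_gt t2_gt1 data_ok.
pose r := (n'.+1 - 8) %/ 4; pose K := (n'.+1 - 16) %/ 4.
have [n_N n_strip] : n'.+1 = (2 * r + 3).+1 * 2 /\ n'.+1 = 16 + 4 * K.
  by rewrite /r /K; split; lia.
exact: (ladder_factorization n_N n_strip isT isT (erefl _) data_ok t2_gt1).
Qed.

Theorem theorem3 (t1 t2 n : nat) (ht1_pos : 0 < t1) (ht2_pos : 0 < t2)
    (ht1_even : ~~ odd t1) (ht2_even : ~~ odd t2)
    (ht1 : t1 \in [:: 4; 6]) (hsum : 14 <= t1 + t2) (hn : n = t1 + t2) :
  exists P : {set {set 'I_n * 'I_n}},
    two_cycle_factorization t1 t2 (complete_symmetric_digraph n) P.
Proof.
rewrite -hn in hsum; have t2_n : t2 = n - t1 by lia.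
have t2_gt1 : 1 < n - t1 by lia.
have n_even : ~~ odd n by lia.
case: n hn hsum t2_n t2_gt1 n_even => // n' _ n_ge -> t2_gt1 n_even.
have [n_4|n_4] : n'.+1 %% 4 = 2 \/ n'.+1 %% 4 = 0 by lia.
  move: ht1; rewrite !inE => /orP[] /eqP t1_eq; rewrite t1_eq in t2_gt1 *.
    by apply: (double_strip_case _ _ n_4 _ t2_gt1 _ _ double_strip_4_14_ok) => // p /mem_take.
  (* The strip used here for [t1 = 6] has at least 18 labels, so n = 14 takes the explicit list. *)
  case: (eqVneq n' 13) => [->|n_neq]; first exact: explicit_factorization factors_6_8_ok _ _.
  by apply: (double_strip_case _ _ n_4 _ t2_gt1 _ _ double_strip_6_18_ok) => //; lia.
have n_gt : 15 < n'.+1 by lia.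
move: ht1; rewrite !inE => /orP[] /eqP t1_eq; rewrite t1_eq in t2_gt1 *.
  exact: ladder_case n_4 n_gt t2_gt1 ladder_4_16_ok.
exact: ladder_case n_4 n_gt t2_gt1 ladder_6_16_ok.
Qed.
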